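(* Consider the mixture model with general weights described in the context. Suppose that the weight distribution is informative: $u_0<1$, $u_1>1$ and $(1-\pi_1)u_0+\pi_1u_1=1$, where $u_j=\mathbb{E}[\omega_t\mid H_t=j]$ for $j=0,1$. Suppose that the p-values $P_t$ are independent, and are conditionally independent of the weights $\omega_t$ given the $H_t$'s. Then the weighted LORD++ rule controls the online FDR at any given level $\alpha\in(0,1)$, i.e. $$\sup_{T\in\mathbb{N}}\ \mathrm{FDR}(T)\le\alpha .$$
   Context: Mixture model with general weights: $0<\pi_1<1$; $H_t$, $t\in\mathbb{N}$, are i.i.d. $\mathrm{Bernoulli}(\pi_1)$ ($H_t=0$ null, $H_t=1$ alternative); $P_t\mid H_t=0\sim\mathrm{Uniform}(0,1)$; $P_t\mid H_t=1$ has a CDF $F$, stochastically smaller than uniform; p-values of different hypotheses are independent; the weights $\omega_t$ are i.i.d. with $\omega_t\mid H_t=0\sim Q_0$ and $\omega_t\mid H_t=1\sim Q_1$, where $Q_0,Q_1$ are continuous probability distributions on $(0,\infty)$ (so marginally $\omega_t\sim(1-\pi_1)Q_0+\pi_1Q_1$); $P_t$ and $\omega_t$ are conditionally independent given $H_t$; and the triples $(H_t,P_t,\omega_t)$ are independent across $t$. LORD++ at level $\alpha$ applied to a sequence $(p_1,p_2,\dots)$: fix $w_0$ with $\alpha/2\le w_0<\alpha$ and a nonnegative non-increasing sequence $(\gamma_t)_{t\ge1}$ with $\sum_{t\ge1}\gamma_t=1$. The decisions are $R_t=\mathbf{1}\{p_t\le\alpha_t\}$ with $$\alpha_t=\gamma_{t-\tau_t}\,b_t,\qquad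 b_t=\alpha-w_0\mathbf{1}\{\rho_1>t-1\},$$ where $\tau_t=\max\{i\in\{1,\dots,t-1\}:R_i=1\}$ ($\tau_t=0$ if there is no rejection before $t$) and $\rho_1$ is the time of the first rejection ($\infty$ if none). (In wealth terms $W(0)=w_0$, penalty $\phi_t=\alpha_t$, reward $\psi_t=b_t$.) Weighted LORD++ means LORD++ at level $\alpha$ applied to the weighted p-values $(P_1/\omega_1,P_2/\omega_2,\dots)$. FDR: $R(T)=\sum_{t=1}^TR_t$, $V(T)=\sum_{t\le T,\,H_t=0}R_t$, $\mathrm{FDR}(T)=\mathbb{E}\big[\frac{V(T)}{R(T)\vee1}\big]$ with $a\vee b=\max\{a,b\}$. *)

(* Defs.v *)
From HB Require Import structures.
From mathcomp Require Import all_boot all_order all_algebra.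
From mathcomp Require Import all_classical all_reals all_analysis.

Set Implicit Arguments.
Unset Strict Implicit.
Unset Printing Implicit Defensive.

Import Order.TTheory GRing.Theory Num.Theory.
Import numFieldNormedType.Exports.

Local Open Scope classical_set_scope.
Local Open Scope ring_scope.

(* Time runs over t = 1, 2, ...: sequences are
   functions on nat whose value at 0 is never used. *)

Section Conditioning.
Context (d : measure_display) (Omega : measurableType d) (R : realType).

(* P( . | E).  [mnormalize] falls back on P when P E = 0. *)
Definition cond_prob (P : probability Omega R) (E : set Omega)
    (mE : measurable E) : probability Omega R :=
  mnormalize (mrestr P mE) P.

Lemma measurable_value (X : {mfun Omega >-> bool}) (b : bool) :
  measurable (X @^-1` [set b]).
Proof. exact: measurable_funPTI. Qed.

Lemma measurable_values (X : nat -> {mfun Omega >-> bool}) (s : seq nat)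
    (b : nat -> bool) :
  measurable (\big[setI/setT]_(t <- s) (X t @^-1` [set b t])).
Proof. by apply: bigsetI_measurable => t _; exact: measurable_value. Qed.

Definition given (P : probability Omega R) (X : {mfun Omega >-> bool})
    (b : bool) : probability Omega R :=
  cond_prob P (measurable_value X b).

Definition given_values (P : probability Omega R)
    (X : nat -> {mfun Omega >-> bool}) (s : seq nat) (b : nat -> bool) :
    probability Omega R :=
  cond_prob P (measurable_values X s b).

End Conditioning.

Section Independence.
Context (d : measure_display) (Omega : measurableType d) (R : realType).
Variable P : probability Omega R.
Local Open Scope ereal_scope.

Definition mutually_independent (d' : measure_display)
    (T : measurableType d') (X : nat -> Omega -> T) : Prop :=
  forall (s : seq nat) (A : nat -> set T),
    uniq s -> all (leq 1) s -> (forall t, measurable (A t)) ->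
    P (\big[setI/setT]_(t <- s) (X t @^-1` A t)) =
    \prod_(t <- s) P (X t @^-1` A t).

Definition independent2 (X Y : Omega -> R) : Prop :=
  forall A B : set R, measurable A -> measurable B ->
    P (X @^-1` A `&` Y @^-1` B) = P (X @^-1` A) * P (Y @^-1` B).

(* The families (X t)_t and (Y t)_t are conditionally independent given the
   family (H t)_t, tested on cylinder sets. *)
Definition cond_independent_families (H : nat -> {mfun Omega >-> bool})
    (X Y : nat -> Omega -> R) : Prop :=
  forall (s : seq nat) (h : nat -> bool) (A B : nat -> set R),
    uniq s -> all (leq 1) s ->
    (forall t, measurable (A t)) -> (forall t, measurable (B t)) ->
    let Ph := given_values P H s h in
    let XA := \big[setI/setT]_(t <- s) (X t @^-1` A t) in
    let YB := \big[setI/setT]_(t <- s) (Y t @^-1` B t) in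
    Ph (XA `&` YB) = Ph XA * Ph YB.

End Independence.

Section MixtureModel.
Context (d : measure_display) (Omega : measurableType d) (R : realType).

Definition continuous_positive_distribution
    (Q : probability R R) : Prop :=
  Q `]0, +oo[%classic = 1%E /\ continuous (fun x : R => fine (Q `]-oo, x]%classic)).

(* F is pointwise above the CDF of Uniform(0,1). *)
Definition stochastically_smaller_than_uniform (F : R -> R) : Prop :=
  forall x : R, (uniform_prob (@ltr01 R) `]-oo, x]%classic <= (F x)%:E)%E.

Record mixture_model (P : probability Omega R)
    (H : nat -> {RV P >-> bool}) (p w : nat -> {RV P >-> R})
    (pi1 : R) (F : R -> R) (Q0 Q1 : probability R R) : Prop :=
  MixtureModel {
    mix_pi1 : 0 < pi1 < 1;
    mix_H : forall t A, (0 < t)%N -> measurable A ->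
      distribution P (H t) A = bernoulli_prob pi1 A;
    mix_p_null : forall t A, (0 < t)%N -> measurable A ->
      distribution (given P (H t) false) (p t) A = uniform_prob (@ltr01 R) A;
    mix_p_alt : forall t x, (0 < t)%N ->
      @cdf _ _ _ (given P (H t) true) (p t) x = (F x)%:E;
    mix_F : stochastically_smaller_than_uniform F;
    mix_Q0 : continuous_positive_distribution Q0;
    mix_Q1 : continuous_positive_distribution Q1;
    mix_w_null : forall t A, (0 < t)%N -> measurable A ->
      distribution (given P (H t) false) (w t) A = Q0 A;
    mix_w_alt : forall t A, (0 < t)%N -> measurable A ->
      distribution (given P (H t) true) (w t) A = Q1 A;
    mix_cond_indep : forall t b, (0 < t)%N ->
      independent2 (given P (H t) b) (p t) (w t);
    mix_indep : mutually_independent P (fun t x => (H t x, p t x, w t x)) }.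

End MixtureModel.

Section LORDpp.
Context (R : realType).
Variables (alpha w0 : R) (gamma : nat -> R).

(* tau_t, with value 0 when there is no rejection in {1, ..., t-1} *)
Definition last_rejection (rej : nat -> bool) (t : nat) : nat :=
  (\max_(1 <= i < t | rej i) i)%N.

(* the event rho_1 > t - 1 *)
Definition no_rejection_before (rej : nat -> bool) (t : nat) : bool :=
  ~~ has rej (index_iota 1 t).

Definition lordpp_reward (rej : nat -> bool) (t : nat) : R :=
  alpha - w0 * (no_rejection_before rej t)%:R.

Definition lordpp_level (rej : nat -> bool) (t : nat) : R :=
  gamma (t - last_rejection rej t) * lordpp_reward rej t.

(* The decisions R_1, ..., R_n, and false at all other times. *)
Fixpoint lordpp_upto (p : nat -> R) (n : nat) : nat -> bool :=
  if n is m.+1 then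
    let rej := lordpp_upto p m in
    fun t => if t == n then p t <= lordpp_level rej t else rej t
  else fun=> false.

Definition lordpp (p : nat -> R) (t : nat) : bool := lordpp_upto p t t.

Lemma lordpp_uptoE (p : nat -> R) (n t : nat) :
  (t <= n)%N -> lordpp_upto p n t = lordpp p t.
Proof.
elim: n => [|n IHn]; first by rewrite leqn0 => /eqP ->.
rewrite leq_eqVlt ltnS => /predU1P[-> //|tn] /=.
by rewrite ltn_eqF ?ltnS// IHn.
Qed.

(* The defining equation R_t = 1{p_t <= alpha_t}. *)
Lemma lordppE (p : nat -> R) (t : nat) : (0 < t)%N ->
  lordpp p t = (p t <= lordpp_level (lordpp p) t).
Proof.
case: t => // n _; rewrite {1}/lordpp /= eqxx.
have eq_rej i : i \in index_iota 1 n.+1 -> lordpp_upto p n i = lordpp p i.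
  by rewrite mem_index_iota ltnS => /andP[_ /lordpp_uptoE].
rewrite /lordpp_level /lordpp_reward /no_rejection_before (eq_in_has eq_rej).
congr (_ <= gamma (_ - _) * _).
rewrite /last_rejection big_seq_cond [RHS]big_seq_cond.
apply: eq_bigl => i.
by case: (boolP (i \in index_iota 1 n.+1)) => // /eq_rej ->.
Qed.

End LORDpp.

Section FDR.
Context (d : measure_display) (Omega : measurableType d) (R : realType).

Definition num_rejections (rej : nat -> bool) (T : nat) : nat :=
  (\sum_(1 <= t < T.+1) rej t)%N.

Definition num_false_rejections (H rej : nat -> bool) (T : nat) : nat :=
  (\sum_(1 <= t < T.+1 | ~~ H t) rej t)%N.

Definition FDR (P : probability Omega R) (H : nat -> Omega -> bool)
    (rej : Omega -> nat -> bool) (T : nat) : \bar R :=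
  'E_P[fun x => (num_false_rejections (H^~ x) (rej x) T)%:R /
                (maxn (num_rejections (rej x) T) 1)%:R].

End FDR.

Definition weighted_lordpp (Omega : Type) (R : realType) (alpha w0 : R)
    (gamma : nat -> R) (p w : nat -> Omega -> R) (x : Omega) : nat -> bool :=
  lordpp alpha w0 gamma (fun t => p t x / w t x).

(* Main.v *)
Require Import Defs.
From HB Require Import structures.
From mathcomp Require Import all_boot all_order all_algebra.
From mathcomp Require Import all_classical all_reals all_analysis.
From mathcomp Require Import measurable_realfun ring lra.
Set Implicit Arguments.
Unset Strict Implicit.
Unset Printing Implicit Defensive.
Import Order.TTheory GRing.Theory Num.Theory.
Import numFieldNormedType.Exports.
Local Open Scope classical_set_scope.
Local Open Scope ring_scope.

(** Given that a hypothesis is null, [p] is uniform and independent of [w], so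
    [p / w <= a] has probability at most [a * u0 <= a]: the weighted p-values
    of the nulls are superuniform ([ratio_superuniform]).  What remains is the
    control of the FDR by LORD++ for independent p-values.

    The usual argument bounds the FDR by the mean of S / max(R, 1), where R
    counts the rejections and S is the sum of the levels.  Here that is not
    enough.  Call the stretch between two consecutive rejections a segment.
    The levels of the first segment add up to at most [alpha - w0], those of
    every later one to at most [alpha], so S can exceed [alpha * R].

    Instead, view every segment as a trial, which succeeds when the segment is
    ended by a false rejection.  A trial succeeds with probability at most
    [alpha].  Complete it so that this probability is exactly [alpha]: if a
    true rejection or the horizon cuts the segment short, play the leftover
    probability at once, and after a success play complete trials until one
    fails.  These virtual false rejections leave the real decisions unchanged
    and can only increase the false discovery proportion.  Now V and R count
    the virtual rejections too.  There are R + 1 trials, and the FDR is at most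
    the mean of V / R, that is, the sum over the trials of E[1/R; success].  It is
    enough to show that

      E[1/R | the trial succeeds] <= E[1/(R + 1)]

    given the past of any trial, since the sum over the trials of
    [alpha] / (R + 1) is [alpha].  If the number of true rejections were fixed,
    then V would be negative binomial and this would be an equality.  In
    general a false rejection can only raise the later levels and favour later
    true rejections, and these only make R larger.

    The p-values of the alternatives, and which hypotheses are null, are first
    fixed: the FDR is multilinear in the laws of the independent tests, so it
    is an average of the values obtained in this way ([path_fdp_mean_le]).
    Then [certificates] proves the inequality by induction on the number of
    remaining tests, following the means of 1/(R + x) over the virtual
    process, and [fdp_from_le] concludes for a fixed environment. *)

(** * Averages over a geometric number of successes *)

Section GeometricAverage.
Context {R : realType}.
Variable alpha : R.
Hypothesis alpha01 : 0 <= alpha < 1.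

(** The mean of [a (i + G)], where [G] is the number of successes before the
    first failure in independent trials of success probability [alpha]: the
    false rejections produced by complete trials. *)
Definition geom_avg (a : nat -> R) (i : nat) : R :=
  limn (series (fun k => (1 - alpha) * alpha ^+ k * a (i + k)%N)).

(** Iterating the second hypothesis gives [alpha ^+ n * - C <= b i] for all
    [n].  With the fixed-point equation [geom_avg_fix], this compares [geom_avg]
    with any bounded solution of the corresponding inequality. *)
Lemma ge0_of_geom_contraction (C : R) (b : nat -> R) :
  (forall i, - C <= b i) -> (forall i, alpha * b i.+1 <= b i) ->
  forall i, 0 <= b i.
Proof.
move=> bC bS i; have [a0 a1] := andP alpha01.
have bn n : - C * alpha ^+ n <= b i.
  apply: (@le_trans _ _ (alpha ^+ n * b (i + n)%N)).
    by rewrite mulrC ler_wpM2l ?exprn_ge0.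
  elim: n => [|n IHn]; first by rewrite expr0 mul1r addn0.
  apply: le_trans IHn; rewrite exprSr -mulrA ler_wpM2l ?exprn_ge0//.
  by rewrite addnS bS.
have cvgC : geometric (- C) alpha @ \oo --> (0 : R).
  by apply: cvg_geometric; rewrite ger0_norm.
apply: (ler_cvg_to cvgC (@cvg_cst _ (b i) _ _ _)).
by near=> n; exact: bn.
Unshelve. all: by end_near. Qed.

Lemma is_cvg_geom_avg a i : (forall j, 0 <= a j <= 1) ->
  cvgn (series (fun k => (1 - alpha) * alpha ^+ k * a (i + k)%N)).
Proof.
move=> a01; have [a0 a1] := andP alpha01.
have g0 n : 0 <= (1 - alpha) * alpha ^+ n.
  by rewrite mulr_ge0 ?exprn_ge0// subr_ge0 ltW.
apply: (@series_le_cvg _ _ (geometric (1 - alpha) alpha)).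
- by move=> n; rewrite mulr_ge0//; case/andP: (a01 (i + n)%N).
- by move=> n; exact: g0.
- by move=> n; rewrite ler_piMr//; case/andP: (a01 (i + n)%N).
- by apply: is_cvg_geometric_series; rewrite ger0_norm.
Qed.

(** Condition on the outcome of the first trial. *)
Lemma geom_avg_fix a i : (forall j, 0 <= a j <= 1) ->
  geom_avg a i = (1 - alpha) * a i + alpha * geom_avg a i.+1.
Proof.
move=> a01; apply: cvg_lim => //; rewrite -cvg_shiftS /=.
have -> : (fun n => series (fun k => (1 - alpha) * alpha ^+ k * a (i + k)%N) n.+1)
  = (fun n => (1 - alpha) * a i +
     alpha * series (fun k => (1 - alpha) * alpha ^+ k * a (i.+1 + k)%N) n).
  apply/funext => n; rewrite /series/= big_nat_recl//= expr0 mulr1 addn0.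
  congr (_ + _); rewrite mulr_sumr; apply: eq_bigr => k _.
  by rewrite addSnnS exprS; ring.
apply: cvgD; first exact: cvg_cst.
by apply: cvgMr; exact: is_cvg_geom_avg.
Qed.

Lemma geom_avg_ge0 a i : (forall j, 0 <= a j <= 1) -> 0 <= geom_avg a i.
Proof.
move=> a01; apply: limr_ge; first exact: is_cvg_geom_avg.
near=> n; apply: sumr_ge0 => k _; have [a0 a1] := andP alpha01.
have [b0 _] := andP (a01 (i + k)%N).
by rewrite mulr_ge0// mulr_ge0 ?exprn_ge0// subr_ge0 ltW.
Unshelve. all: by end_near. Qed.

Lemma geom_avg_le1 a i : (forall j, 0 <= a j <= 1) -> geom_avg a i <= 1.
Proof.
move=> a01; have [a0 a1] := andP alpha01.
have : series (geometric (1 - alpha) alpha) @ \oo -->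
    ((1 - alpha) * (1 - alpha)^-1 : R).
  by apply: cvg_geometric_series; rewrite ger0_norm.
rewrite divff ?subr_eq0 ?gt_eqF// => g1.
rewrite -(cvg_lim _ g1)//; apply: lim_series_le.
- exact: is_cvg_geom_avg.
- by apply/cvg_ex; exists 1.
- move=> n /=; rewrite ler_piMr//; last by case/andP: (a01 (i + n)%N).
  by rewrite mulr_ge0 ?exprn_ge0// subr_ge0 ltW.
Qed.

Lemma geom_avg_le (C : R) a z : (forall j, 0 <= a j <= 1) ->
  (forall i, - C <= z i) ->
  (forall i, (1 - alpha) * a i + alpha * z i.+1 <= z i) ->
  forall i, geom_avg a i <= z i.
Proof.
move=> a01 zC zS i; rewrite -subr_ge0.
apply: (@ge0_of_geom_contraction (C + 1) (fun i => z i - geom_avg a i)) => j.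
  by have := zC j; have := geom_avg_le1 j a01; lra.
by have := zS j; rewrite (geom_avg_fix j a01); lra.
Qed.

Lemma le_geom_avg (C : R) a z : (forall j, 0 <= a j <= 1) ->
  (forall i, z i <= C) ->
  (forall i, z i <= (1 - alpha) * a i + alpha * z i.+1) ->
  forall i, z i <= geom_avg a i.
Proof.
move=> a01 zC zS i; rewrite -subr_ge0.
apply: (@ge0_of_geom_contraction C (fun i => geom_avg a i - z i)) => j.
  by have := zC j; have := geom_avg_ge0 j a01; lra.
by have := zS j; rewrite (geom_avg_fix j a01); lra.
Qed.

Lemma ler_geom_avg a b : (forall j, 0 <= a j <= 1) ->
  (forall j, 0 <= b j <= 1) -> (forall j, a j <= b j) ->
  forall i, geom_avg a i <= geom_avg b i.
Proof.
move=> a01 b01 ab; have [a0 a1] := andP alpha01.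
apply: (@geom_avg_le 0) => // i; first by rewrite oppr0 geom_avg_ge0.
by rewrite (geom_avg_fix i b01) lerD2r ler_wpM2l// subr_ge0 ltW.
Qed.

End GeometricAverage.

(** * Rejections as successes of independent trials *)
Section Trials.
Context {R : realType}.
Variable alpha : R.
Hypothesis alpha01 : 0 <= alpha < 1.
Local Notation G := (geom_avg alpha).

Definition inv_succ (x : nat) : R := x.+1%:R^-1.

Lemma inv_succ_ge0 x : 0 <= inv_succ x. Proof. by rewrite invr_ge0. Qed.

Lemma inv_succ_le1 x : inv_succ x <= 1.
Proof. by rewrite invf_le1// ler1n. Qed.

Lemma inv_succ_nonincr x : inv_succ x.+1 <= inv_succ x.
Proof. by rewrite /inv_succ lef_pV2 ?posrE// ler_nat. Qed.

Lemma mul_inv_succ x : (x%:R + 1) * inv_succ x = 1.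
Proof. by rewrite /inv_succ natr1 divff. Qed.

Lemma le_inv_succ01 (a : nat -> R) : (forall x, 0 <= a x <= inv_succ x) ->
  forall x, 0 <= a x <= 1.
Proof.
by move=> ah x; case/andP: (ah x) => -> /le_trans -> //; exact: inv_succ_le1.
Qed.

Lemma geom_avg_le_nonincr (a b : nat -> R) : (forall x, 0 <= a x <= 1) ->
  (forall x, 0 <= b x) ->
  (forall x, b x.+1 <= b x) -> (forall x, a x <= b x) -> forall x, G a x <= b x.
Proof.
move=> a01 b0 bS ab; apply: (@geom_avg_le _ _ alpha01 0) => // x.
  by rewrite oppr0.
have := bS x; have := ab x; have [a0 a1] := andP alpha01; have := b0 x.
by move=> *; nra.
Qed.

(** The Stein identity of the geometric law, E[G f(G)] = alpha E[(G+1) f(G+1)],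
    turns the bound on [W 0] into a bound on the average of [W] after at least
    one success.  Here [W v u] stands for a mean false discovery proportion
    when [v] false and [u] true rejections are already counted, and [k x] for
    the corresponding mean of 1/(x + 1 + R), with R the rejections to come. *)
Lemma geom_avg_stein (k : nat -> R) (W : nat -> nat -> R) :
  (forall x, 0 <= k x <= inv_succ x) ->
  (forall v u, 0 <= W v u <= 1) ->
  (forall v u, W v.+1 u <= k (v + u)%N + W v u.+1) ->
  (forall x, W 0%N x <= alpha * (1 - x.+1%:R * k x)) ->
  forall u, G (W^~ u) 1 <= G k u + alpha * (1 - u.+1%:R * G k u.+1).
Proof.
move=> kh W01 Wk W0 u; have [a0 a1] := andP alpha01.
have k01 := le_inv_succ01 kh.
have g0 x : 0 <= G k x by exact: geom_avg_ge0.
have gh x : G k x <= inv_succ x.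
  apply: geom_avg_le_nonincr => // {}x;
    [exact: inv_succ_ge0|exact: inv_succ_nonincr|].
  by case/andP: (kh x).
have Wkv v x : W v.+1 x <= v.+1%:R * k (v + x)%N + W 0%N (x + v.+1)%N.
  elim: v x => [|v IHv] x; first by rewrite mul1r addn1.
  apply: (le_trans (Wk _ _)); apply: (le_trans (lerD (lexx _) (IHv _))).
  rewrite (addSnnS x) -(addSnnS v) (mulrS 1 v.+1) mulrDl mul1r addrA.
  exact: lexx.
(* The mean of the bound [Wkv], combined with [W0], computed in closed form
   by the Stein identity; it is a fixed point of the equation below. *)
pose z i := i.+1%:R * G k (u + i)%N +
  alpha * (1 - (u + i).+1%:R * G k (u + i).+1).
have -> : G k u + alpha * (1 - u.+1%:R * G k u.+1) = z 0%N.
  by rewrite /z addn0 mul1r.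
rewrite -[G _ 1]/(G (fun i => W i.+1 u) 0).
apply: (@geom_avg_le _ _ alpha01 0) => [i //|i|i].
  rewrite oppr0 /z addr_ge0 ?mulr_ge0// subr_ge0.
  rewrite -[leRHS](mul_inv_succ (u + i).+1) ler_pM//.
  by rewrite lerDl.
have := Wkv i u; have := W0 (u + i.+1)%N; rewrite /z.
rewrite (geom_avg_fix alpha01 (u + i) k01) !addnS.
rewrite (geom_avg_fix alpha01 (u + i).+1 k01).
rewrite (addnC i u) -!natr1.
move: (G k _) (k _) (k _) (W _ _) (W _ _) => g2 k0 k1 w0 wi.
rewrite natrD; move: (i%:R) (u%:R) => I U h1 h2.
nra.
Qed.

Lemma geom_avg_nonincr (a : nat -> R) : (forall x, 0 <= a x <= 1) ->
  (forall x, a x.+1 <= a x) -> forall x, G a x.+1 <= G a x.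
Proof.
move=> a01 aS x; rewrite -[G a x.+1]/(G (fun i => a i.+1) x).
by apply: ler_geom_avg => // i.
Qed.

Lemma geom_avg_nondecr (a : nat -> R) : (forall x, 0 <= a x <= 1) ->
  (forall x, a x <= a x.+1) -> forall x, G a x <= G a x.+1.
Proof.
move=> a01 aS x; rewrite -[G a x.+1]/(G (fun i => a i.+1) x).
by apply: ler_geom_avg => // i.
Qed.

Lemma geom_avg_exchange (k : nat -> R) (W : nat -> nat -> R) :
  (forall x, 0 <= k x <= 1) -> (forall v u, 0 <= W v u <= 1) ->
  (forall v u, W v.+1 u <= k (v + u)%N + W v u.+1) ->
  forall v u, G (W^~ u) v.+1 <= G k (v + u)%N + G (W^~ u.+1) v.
Proof.
move=> k01 W01 Wk v u; have [a0 a1] := andP alpha01.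
have W01' x : forall v, 0 <= W v x <= 1 by [].
rewrite -[G _ v.+1]/(G (fun i => W i.+1 u) v).
apply: (@geom_avg_le _ _ alpha01 0 _
  (fun i => G k (i + u)%N + G (W^~ u.+1) i)) => // i.
  by rewrite oppr0 addr_ge0// geom_avg_ge0.
rewrite (geom_avg_fix alpha01 (i + u) k01).
rewrite (geom_avg_fix alpha01 i (W01' u.+1)).
by have := Wk i u; rewrite addSn => *; nra.
Qed.

Lemma le_geom_avg_nondecr (a : nat -> R) : (forall x, 0 <= a x <= 1) ->
  (forall x, a x <= a x.+1) -> forall x, a x <= G a x.
Proof.
move=> a01 aS; apply: (@le_geom_avg _ _ alpha01 1) => // x.
  by case/andP: (a01 x).
have := aS x; have [a0 a1] := andP alpha01.
by move=> *; nra.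
Qed.

(** What the induction maintains for a segment in progress whose trial still
    succeeds with probability [p].  Let R be the number of rejections to come,
    virtual ones included.  Then
    - [N x] is the mean of 1/(x + 1 + R) if the trial fails,
    - [c x] is the mean of 1/(x + R) on the event that the trial succeeds,
      R counting that success (so that [(1 - p) * N x + c x.+1] is the mean of
      1/(x + 1 + R)),
    - [W v u] is the mean false discovery proportion at the end if [v] false
      and [u] true rejections occurred so far.
    The field [cert_cN] compares a success with its least favourable
    continuation: complete trials until one fails, and then what follows a
    failure of the current trial.  It is an equality for that continuation.
    The field [cert_W0] bounds the contribution of the current trial by [c u]
    and that of the R later ones by the mean of [alpha] R/(u + 1 + R). *)
Record certificate (p : R) (N c : nat -> R) (W : nat -> nat -> R) : Prop := {
  cert_N : forall x, 0 <= N x <= inv_succ x;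
  cert_NS : forall x, N x.+1 <= N x;
  cert_c : forall x, 0 <= c x <= p * inv_succ x;
  cert_cS : forall x, c x.+1 <= c x;
  cert_cN : forall x, c x - alpha * c x.+1 <= p * (1 - alpha) * N x;
  cert_W : forall v u, 0 <= W v u <= 1;
  cert_WS : forall v u, W v u <= W v.+1 u;
  cert_Wk : forall v u,
    W v.+1 u <= (1 - p) * N (v + u)%N + c (v + u).+1 + W v u.+1;
  cert_W0 : forall u,
    W 0%N u <= alpha * (1 - u.+1%:R * ((1 - p) * N u + c u.+1)) + c u }.

(** The same information at a moment when the trial is certain to fail, so
    that only the mean [k x] of 1/(x + 1 + R) is left. *)
Record profile (k : nat -> R) (W : nat -> nat -> R) : Prop := {
  prof_k : forall x, 0 <= k x <= inv_succ x;
  prof_kS : forall x, k x.+1 <= k x;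
  prof_W : forall v u, 0 <= W v u <= 1;
  prof_WS : forall v u, W v u <= W v.+1 u;
  prof_Wk : forall v u, W v.+1 u <= k (v + u)%N + W v u.+1;
  prof_W0 : forall u, W 0%N u <= alpha * (1 - u.+1%:R * k u) }.

(** A segment which can no longer be ended by a real false rejection: its
    leftover [p] is played at once, followed by complete trials after a
    success. *)
Lemma certificate_close p k W : 0 <= p <= alpha -> profile k W ->
  certificate p k (fun x => p * G k x)
    (fun v u => (1 - p) * W v u + p * G (W^~ u) v.+1).
Proof.
move=> /andP[p0 pa] [kh kS W01 WS Wk W0]; have [a0 a1] := andP alpha01.
have k01 := le_inv_succ01 kh; have p1 : p <= 1 by lra.
have q0 : 0 <= 1 - p by lra.
have Gk0 x : 0 <= G k x by exact: geom_avg_ge0.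
have GW0 u v : 0 <= G (W^~ u) v by exact: geom_avg_ge0.
have GWle u v : G (W^~ u) v <= 1 by exact: geom_avg_le1.
split=> //.
- move=> x; rewrite mulr_ge0//= ler_wpM2l//.
  apply: geom_avg_le_nonincr => // {}x;
    [exact: inv_succ_ge0|exact: inv_succ_nonincr|].
  by case/andP: (kh x).
- by move=> x; rewrite ler_wpM2l// geom_avg_nonincr.
- by move=> x; rewrite (geom_avg_fix alpha01 x k01); lra.
- move=> v u; have := GWle u v.+1; have := GW0 u v.+1.
  by have /andP[] := W01 v u => *; apply/andP; split; nra.
- move=> v u; apply: lerD; rewrite ler_wpM2l//.
  exact: (@geom_avg_nondecr (W^~ u)).
- move=> v u; have := geom_avg_exchange k01 W01 Wk v.+1 u.
  have := Wk v u; rewrite addSn.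
  move: (W _ _) (G _ _) (G _ _) (G _ _) (k _) (W _ _) => *.
  nra.
- move=> u; have := geom_avg_stein kh W01 Wk W0 u.
  have := W0 u; move: (W _ _) (G _ _) (G _ _) (G _ _) => *.
  nra.
Qed.

Definition mean_inv (p : R) (N c : nat -> R) (x : nat) : R :=
  (1 - p) * N x + c x.+1.

(** Just after a rejection a complete trial begins, so that [p] is [alpha]. *)
Section Fresh.
Variables (N c : nat -> R) (W : nat -> nat -> R).
Hypothesis fresh : certificate alpha N c W.
Local Notation k := (mean_inv alpha N c).

Lemma fresh_bounds x : 0 <= k x <= inv_succ x.
Proof.
have [a0 a1] := andP alpha01; have := inv_succ_nonincr x; have := inv_succ_ge0 x.
have /andP[] := cert_N fresh x; have /andP[] := cert_c fresh x.+1.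
by rewrite /mean_inv => *; apply/andP; split; nra.
Qed.

Lemma fresh_nonincr x : k x.+1 <= k x.
Proof.
have [a0 a1] := andP alpha01; have := cert_NS fresh x.
by have := cert_cS fresh x.+1; rewrite /mean_inv; nra.
Qed.

(** Equality for all [x] would make [k] the geometric average of [N]: complete
    trials until one fails, and then what follows the failure.  In general
    there are at least as many rejections, hence an inequality. *)
Lemma fresh_recovery x : k x - alpha * k x.+1 <= (1 - alpha) * N x.
Proof. by have := cert_cN fresh x.+1; rewrite /mean_inv; lra. Qed.

(** [cert_cN] absorbs the contribution [c u] of the trial: this is the
    inequality E[1/R | success] <= E[1/(R + 1)]. *)
Lemma fresh_false_start u : W 0%N u <= alpha * (1 - u%:R * k u).
Proof.
have := cert_W0 fresh u; have := cert_cN fresh u; rewrite -/(k u) -natr1.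
have -> : c u.+1 = k u - (1 - alpha) * N u by rewrite /mean_inv; ring.
by move=> *; lra.
Qed.

(** The situation seen from just before a true rejection, which shifts the
    count of rejections by one. *)
Lemma fresh_profile : profile (fun x => k x.+1) (fun v u => W v u.+1).
Proof.
split=> [x|x|v u|v u|v u|u].
- have /andP[-> kh] := fresh_bounds x.+1.
  exact: le_trans kh (inv_succ_nonincr x).
- exact: fresh_nonincr.
- exact: (cert_W fresh).
- exact: (cert_WS fresh).
- by have := cert_Wk fresh v u.+1; rewrite addnS.
- exact: (fresh_false_start u.+1).
Qed.

End Fresh.

(** A null rejected with probability [q] either ends the segment, which starts
    a complete trial, or brings the leftover down to the conditional
    probability [(p - q) / (1 - q)]. *)
Lemma certificate_null p q N N1 c1 W1 c W :
  0 <= q <= p -> p <= alpha ->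
  certificate alpha N1 c1 W1 -> (forall x, N1 x <= N x) ->
  certificate ((p - q) / (1 - q)) N c W ->
  certificate p N
    (fun x => q * mean_inv alpha N1 c1 x + (1 - q) * c x)
    (fun v u => q * W1 v.+1 u + (1 - q) * W v u).
Proof.
move=> /andP[q0 qp] pa f1 N1N; have [a0 a1] := andP alpha01.
have q1 : 0 < 1 - q by lra.
have : (1 - q) * ((p - q) / (1 - q)) = p - q by rewrite mulrC divfK// gt_eqF.
move: (_ / _) => p' p'E f.
have p'E' : (1 - q) * (1 - p') = 1 - p by lra.
set k1 := mean_inv _ _ _.
split=> [x|x|x|x|x|v u|v u|v u|u].
- exact: cert_N f x.
- exact: cert_NS f x.
- have /andP[c0 ch] := cert_c f x; have /andP[k0 kh] := fresh_bounds f1 x.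
  rewrite addr_ge0 ?mulr_ge0// ?(ltW q1)//=.
  have -> : p * inv_succ x = q * inv_succ x + (1 - q) * (p' * inv_succ x).
    by rewrite mulrA p'E; ring.
  by apply: lerD; rewrite ler_wpM2l// ltW.
- by apply: lerD; rewrite ler_wpM2l// ?(fresh_nonincr f1) ?(cert_cS f) ?ltW.
- have -> : p * (1 - alpha) * N x =
    q * ((1 - alpha) * N x) + (1 - q) * (p' * (1 - alpha) * N x).
    by rewrite !mulrA p'E; ring.
  have : k1 x - alpha * k1 x.+1 <= (1 - alpha) * N x.
    by apply: (le_trans (fresh_recovery f1 x)); rewrite ler_wpM2l//; lra.
  move=> /(ler_wpM2l q0); have := ler_wpM2l (ltW q1) (cert_cN f x).
  by lra.
- have := cert_W f v u; have := cert_W f1 v.+1 u.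
  by move=> /andP[? ?] /andP[? ?]; apply/andP; split; nra.
- by apply: lerD; rewrite ler_wpM2l// ?(cert_WS f1) ?(cert_WS f) ?ltW.
- have := ler_wpM2l (ltW q1) (cert_Wk f v u).
  have := ler_wpM2l q0 (cert_Wk f1 v.+1 u); rewrite -/(mean_inv alpha N1 c1 _) -/k1.
  have := congr1 ( *%R^~ (N (v + u)%N)) p'E'.
  by rewrite addSn /= /k1 /mean_inv; lra.
- have := ler_wpM2l (ltW q1) (cert_W0 f u).
  have := cert_Wk f1 0%N u; rewrite -/(mean_inv alpha N1 c1 _) -/k1 add0n => h1.
  have := fresh_false_start f1 u.+1; rewrite -/k1 => h2.
  have : q * W1 1%N u <= q * (k1 u + alpha * (1 - u.+1%:R * k1 u.+1)).
    by rewrite ler_wpM2l//; lra.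
  by rewrite -p'E' /mean_inv; lra.
Qed.

(** * A fixed environment *)

(** [y i] is [None] if hypothesis [i] is null, and [Some j] if it is an
    alternative whose p-value leads to a rejection exactly when the last
    rejection occurred at time [j] or later: levels increase with the time of
    the last rejection, so every value of the p-value is of this form.
    [q i tau] is the probability of rejecting the null hypothesis [i] if the
    last rejection occurred at time [tau]. *)
Section Environment.
Variables (q : nat -> nat -> R) (y : nat -> option nat).
Hypothesis q_ge0 : forall i tau, 0 <= q i tau.
Hypothesis q_budget : forall tau n,
  \sum_(tau.+1 <= i < tau.+1 + n) q i tau <= alpha.

(** The mean false discovery proportion after [n] more tests, when [t] tests
    have been made, the last rejection occurred at time [tau], and [v] false
    and [u] true rejections are counted. *)
Fixpoint fdp_from (n t tau v u : nat) : R :=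
  if n is m.+1 then
    match y t.+1 with
    | None => q t.+1 tau * fdp_from m t.+1 t.+1 v.+1 u +
              (1 - q t.+1 tau) * fdp_from m t.+1 tau v u
    | Some j => if (j <= tau)%N then fdp_from m t.+1 t.+1 v u.+1
                else fdp_from m t.+1 tau v u
    end
  else v%:R / (v + u)%:R.

(** The leftover [p] covers all the probability that the nulls to come may
    still use in the current segment. *)
Definition affordable (n t tau : nat) (p : R) : Prop :=
  (tau <= t)%N /\ \sum_(t.+1 <= i < t.+1 + n) q i tau <= p <= alpha.

Lemma affordable_fresh n t : affordable n t t alpha.
Proof. by split=> //; rewrite q_budget/=. Qed.

Lemma affordable_budget n t tau p : affordable n t tau p -> 0 <= p <= alpha.
Proof.
by move=> [_ /andP[qp ->]]; rewrite (le_trans _ qp)// sumr_ge0.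
Qed.

Lemma affordable_skip n t tau p :
  affordable n.+1 t tau p -> affordable n t.+1 tau p.
Proof.
move=> [tt /andP[qp pa]]; split; first exact: leqW.
rewrite pa andbT (le_trans _ qp)// addnS -addSn [leRHS]big_ltn.
  by rewrite lerDr.
by rewrite addSn ltnS leq_addr.
Qed.

Lemma affordable_test n t tau p : affordable n.+1 t tau p ->
  q t.+1 tau <= p /\
  affordable n t.+1 tau ((p - q t.+1 tau) / (1 - q t.+1 tau)).
Proof.
move=> pn; have [tt /andP[]] := pn.
have [a0 a1] := andP alpha01; have /andP[p0 pa] := affordable_budget pn.
rewrite addnS -addSn big_ltn; last by rewrite addSn ltnS leq_addr.
set s := \sum_(_ <= _ < _) _ => qsp _.
have s0 : 0 <= s by exact: sumr_ge0.
have q0 := q_ge0 t.+1 tau; have qp : q t.+1 tau <= p by lra.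
split=> //; split; first exact: leqW.
rewrite -/s; have q1 : 0 < 1 - q t.+1 tau by lra.
rewrite ler_pdivlMr// ler_pdivrMr//; apply/andP; split; nra.
Qed.

(** At the horizon no real rejection is to come. *)
Lemma fdp_profile :
  profile inv_succ (fun v u => v%:R / (v + u)%:R).
Proof.
have [a0 a1] := andP alpha01.
split=> [x|x|v u|v u|v u|u].
- by rewrite inv_succ_ge0/=.
- exact: inv_succ_nonincr.
- rewrite divr_ge0//=.
  case: (posnP (v + u)) => [->|vu]; first by rewrite invr0 mulr0.
  by rewrite ler_pdivrMr ?ltr0n// mul1r ler_nat leq_addr.
- case: (posnP (v + u)) => [->|vu]; first by rewrite invr0 mulr0 divr_ge0.
  rewrite ler_pdivrMr ?ltr0n// mulrAC ler_pdivlMr ?ltr0n// -!natrM ler_nat.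
  by rewrite addSn mulnS mulSn leq_add2r leq_addr.
- by rewrite addSnnS -(natr1 v) mulrDl mul1r addrC /inv_succ addnS.
- by rewrite mul0r -natr1 mul_inv_succ subrr mulr0.
Qed.

(** The middle clause is where the monotonicity of the rule enters: among the
    segments alive at time [t], those with a more recent last rejection are
    followed by at least as many rejections when their trial fails. *)
Lemma certificates n t : exists (N : nat -> nat -> R)
  (c : nat -> R -> nat -> R) (W : nat -> R -> nat -> nat -> R),
  [/\ forall tau p, affordable n t tau p ->
        certificate p (N tau) (c tau p) (W tau p),
      forall tau tau' x, (tau <= tau' <= t)%N -> N tau' x <= N tau x &
      forall tau p v u, affordable n t tau p ->
        fdp_from n t tau v u <= W tau p v u].
Proof.
have close_le p k W v u : 0 <= p <= alpha -> profile k W ->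
    W v u <= (1 - p) * W v u + p * G (W^~ u) v.+1.
  move=> /andP[p0 pa] W_; have W01 := prof_W W_ ^~ u.
  have := le_geom_avg_nondecr W01 (prof_WS W_ ^~ u) v.
  have := geom_avg_nondecr W01 (prof_WS W_ ^~ u) v.
  by move=> *; nra.
elim: n t => [|n IHn] t.
  exists (fun _ => inv_succ), (fun _ p x => p * G inv_succ x), (fun _ p v u =>
    let f v u := v%:R / (v + u)%:R in (1 - p) * f v u + p * G (f^~ u) v.+1).
  split=> // [tau p|tau p v u] /affordable_budget pa.
    exact: certificate_close fdp_profile.
  exact: close_le fdp_profile.
have [N [c [W [cert Nmono fdpW]]]] := IHn t.+1.
have fresh := cert _ _ (affordable_fresh n t.+1).
(* A rejection at time t + 1, counted with those that follow it, gives at least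
   as many rejections as a failure in any segment alive at time t. *)
have freshN tau x : (tau <= t)%N ->
    mean_inv alpha (N t.+1) (c t.+1 alpha) x.+1 <= N tau x.
  move=> tt; have := fresh_recovery fresh x; have := fresh_nonincr fresh x.
  have := Nmono tau t.+1 x; rewrite leqnn (leqW tt) => /(_ isT).
  by have [a0 a1] := andP alpha01; move=> *; nra.
case yt: (y t.+1) => [j|].
  set k := mean_inv alpha (N t.+1) (c t.+1 alpha).
  pose k' x := k x.+1; pose W' v u := W t.+1 alpha v u.+1.
  have k'W' : profile k' W' := fresh_profile fresh.
  exists (fun tau x => if (j <= tau)%N then k' x else N tau x).
  exists (fun tau p x => if (j <= tau)%N then p * G k' x else c tau p x).
  exists (fun tau p v u => if (j <= tau)%N then
    (1 - p) * W' v u + p * G (W'^~ u) v.+1 else W tau p v u).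
  split.
  - move=> tau p pn /=; case: (leqP j tau) => jt.
      by apply: certificate_close => //; exact: affordable_budget pn.
    exact/cert/affordable_skip.
  - move=> tau tau' x /andP[tt' t't] /=; case: (leqP j tau') => jt'.
      by case: leqP => // _; apply: freshN; exact: leq_trans t't.
    by rewrite leqNgt (leq_ltn_trans tt' jt')/= Nmono// tt' leqW.
  - move=> tau p v u pn; rewrite /= yt; case: (leqP j tau) => jt.
      apply: le_trans (close_le p k' W' v u (affordable_budget pn) k'W').
      by apply: fdpW; exact: affordable_fresh.
    by apply: fdpW; exact: affordable_skip.
pose k := mean_inv alpha (N t.+1) (c t.+1 alpha).
pose p' p tau := (p - q t.+1 tau) / (1 - q t.+1 tau).
exists N, (fun tau p x => q t.+1 tau * k x +
  (1 - q t.+1 tau) * c tau (p' p tau) x).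
exists (fun tau p v u => q t.+1 tau * W t.+1 alpha v.+1 u +
  (1 - q t.+1 tau) * W tau (p' p tau) v u).
split.
- move=> tau p pn; have [tt _] := pn; have [qp pn'] := affordable_test pn.
  apply: (certificate_null _ _ fresh) => //.
  + by rewrite q_ge0.
  + by case/andP: (affordable_budget pn).
  + by move=> x; rewrite Nmono// leqnn leqW.
  + exact: cert.
- by move=> tau tau' x /andP[tt' t't]; rewrite Nmono// tt' leqW.
- move=> tau p v u pn; have [qp pn'] := affordable_test pn; rewrite /= yt.
  have /andP[_ pa] := affordable_budget pn; have [a0 a1] := andP alpha01.
  apply: lerD; rewrite ler_wpM2l ?fdpW//; first exact: affordable_fresh.
  by rewrite subr_ge0; lra.
Qed.

Lemma fdp_from_le n : fdp_from n 0 0 0 0 <= alpha.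
Proof.
have [N [c [W [cert _ fdpW]]]] := certificates n 0.
have fresh := affordable_fresh n 0.
apply: (le_trans (fdpW _ _ 0%N 0%N fresh)).
by have := fresh_false_start (cert _ _ fresh) 0; rewrite mul0r subr0 mulr1.
Qed.

End Environment.
End Trials.

(** * Averaging over environments *)
Lemma big_tuple_cons (R : nmodType) (X : finType) (n : nat)
    (F : n.+1.-tuple X -> R) :
  \sum_(s : n.+1.-tuple X) F s = \sum_x \sum_(s : n.-tuple X) F (cons_tuple x s).
Proof.
rewrite (reindex (fun p : X * n.-tuple X => cons_tuple p.1 p.2)) /=.
  by rewrite pair_big.
exists (fun s : n.+1.-tuple X => (thead s, behead_tuple s)) => [[x s] _|s _] /=.
  by congr (_, _); exact: val_inj.
by rewrite [RHS]tuple_eta; exact: val_inj.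
Qed.

Lemma big_bool_pair (R : nmodType) (X : finType) (F : bool * X -> R) :
  \sum_x F x = \sum_j F (true, j) + \sum_j F (false, j).
Proof.
rewrite (eq_bigr (fun x => F (x.1, x.2))) => [|[]//].
by rewrite -(pair_bigA _ (fun b j => F (b, j)))/= big_bool.
Qed.

Section Paths.
Context {R : realType}.
Variable N : nat.
Local Notation outcome := (bool * 'I_N)%type.

(** An outcome [(h, j)] says whether the hypothesis is an alternative, and that
    it is rejected exactly when the last rejection is at time [j] or later. *)
Fixpoint path_fdp (s : seq outcome) (t tau v u : nat) : R :=
  if s is x :: s' then
    if (x.2 <= tau)%N then
      if x.1 then path_fdp s' t.+1 t.+1 v u.+1 else path_fdp s' t.+1 t.+1 v.+1 u
    else path_fdp s' t.+1 tau v u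
  else v%:R / (v + u)%:R.

Variables (nu : nat -> 'I_N -> R).

(** The law of an outcome in a fixed environment: a point mass for an
    alternative, the conditional law [nu t] for a null. *)
Definition pure_law (t : nat) (e : option 'I_N) (x : outcome) : R :=
  if e is Some j then (x == (true, j))%:R else if x.1 then 0 else nu t x.2.

Lemma sum_pure_law (q : nat -> nat -> R) (y : nat -> option 'I_N) n t tau v u :
  (tau <= t)%N ->
  (forall i, (t < i <= t + n)%N -> \sum_(j < N) nu i j = 1) ->
  (forall i k, (t < i <= t + n)%N -> (k < i)%N ->
     \sum_(j < N | (j <= k)%N) nu i j = q i k) ->
  \sum_(s : n.-tuple outcome) path_fdp s t tau v u *
     \prod_(i < n) pure_law (t + i).+1 (y (t + i).+1) (tnth s i) =
  fdp_from q (fun i => omap val (y i)) n t tau v u.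
Proof.
elim: n t tau v u => [|n IHn] t tau v u tt nu1 nuq.
  rewrite (big_pred1 [tuple]) => [|s].
    by rewrite big_ord0 mulr1.
  by apply/esym/eqP; exact: val_inj (size0nil (size_tuple s)).
have wt i : (t.+1 < i <= t.+1 + n)%N -> (t < i <= t + n.+1)%N.
  by rewrite addnS -addSn => /andP[/ltnW -> ->].
have tn : (t < t.+1 <= t + n.+1)%N by rewrite ltnSn addnS ltnS leq_addr.
have {}IHn k v' u' : (k <= t.+1)%N -> _ :=
  fun kt => IHn t.+1 k v' u' kt (fun i h => nu1 i (wt i h))
                                (fun i j h => nuq i j (wt i h)).
rewrite big_tuple_cons.
have stepE x : \sum_(s : n.-tuple outcome)
    path_fdp (cons_tuple x s) t tau v u *
    \prod_(i < n.+1) pure_law (t + i).+1 (y (t + i).+1) (tnth (cons_tuple x s) i)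
  = pure_law t.+1 (y t.+1) x *
    (if (x.2 <= tau)%N then
      if x.1 then fdp_from q (fun i => omap val (y i)) n t.+1 t.+1 v u.+1
      else fdp_from q (fun i => omap val (y i)) n t.+1 t.+1 v.+1 u
     else fdp_from q (fun i => omap val (y i)) n t.+1 tau v u).
  under eq_bigr => s _.
    rewrite big_ord_recl /= addn0 (tnth0 x s) mulrCA.
    under eq_bigr => i _ do rewrite /bump/= add1n addnS -addSn tnthS.
    over.
  rewrite -mulr_sumr; congr (_ * _).
  by case: ifP => _; [case: ifP => _|]; rewrite IHn// leqW.
under eq_bigr => x _ do rewrite stepE.
rewrite /= /pure_law; case: (y t.+1) => [j|] /=.
  rewrite (bigD1 (true, j))//= eqxx mul1r big1 ?addr0// => x /negPf ->.
  by rewrite mul0r.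
rewrite big_bool_pair/= big1 ?add0r => [|j _]; last by rewrite mul0r.
have -> : 1 - q t.+1 tau = \sum_(j < N | ~~ (j <= tau)%N) nu t.+1 j.
  rewrite -(nuq _ _ tn)// -(nu1 _ tn).
  by rewrite (bigID (fun j : 'I_N => (j <= tau)%N))/= addrAC subrr add0r.
rewrite -(nuq _ _ tn)// (bigID (fun j : 'I_N => (j <= tau)%N))/=.
rewrite !mulr_suml; congr (_ + _); apply: eq_bigr => j; first by move=> ->.
by move=> /negPf ->.
Qed.

End Paths.

Lemma big_option (R : nmodType) (X : finType) (F : option X -> R) :
  \sum_e F e = F None + \sum_x F (Some x).
Proof.
rewrite (bigD1 None)//=; congr (_ + _).
rewrite (reindex_omap Some id) => [|[x|]//] /=.
by apply: eq_bigl => x; rewrite eqxx.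
Qed.

Lemma path_fdp_ge0 (R : realType) N (s : seq (bool * 'I_N)) t tau v u :
  0 <= path_fdp s t tau v u :> R.
Proof.
elim: s t tau v u => [|x s IHs] t tau v u /=; first by rewrite divr_ge0.
by case: ifP => _; [case: ifP|].
Qed.

(** Every law [mu i] is a mixture of pure laws.  Expanding the product of these
    mixtures writes the mean as an average over environments. *)
Lemma path_fdp_mean_le (R : realType) (N : nat) (alpha : R)
    (mu : nat -> bool * 'I_N -> R) (q : nat -> nat -> R) (T : nat) :
  0 <= alpha < 1 ->
  (forall i tau, 0 <= q i tau) ->
  (forall tau n, \sum_(tau.+1 <= i < tau.+1 + n) q i tau <= alpha) ->
  (forall i x, 0 <= mu i x) ->
  (forall i, (0 < i <= T)%N -> \sum_x mu i x = 1) ->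
  (forall i, (0 < i <= T)%N -> 0 < \sum_j mu i (false, j)) ->
  (forall i k, (0 < i <= T)%N -> (k < i)%N ->
    \sum_(j < N | (j <= k)%N) mu i (false, j) =
    q i k * \sum_j mu i (false, j)) ->
  \sum_(s : T.-tuple (bool * 'I_N)) path_fdp s 0 0 0 0 *
    \prod_(i < T) mu i.+1 (tnth s i) <= alpha.
Proof.
move=> alpha01 q0 qB mu0 mu1 mF muq.
pose m i := \sum_j mu i (false, j).
pose nu i (j : 'I_N) := mu i (false, j) / m i.
pose lam i (e : option 'I_N) := if e is Some j then mu i (true, j) else m i.
have lam0 i e : 0 <= lam i e by case: e => [j|] //=; exact: sumr_ge0.
have it (i : 'I_T) : (0 < i.+1 <= T)%N := ltn_ord i.
have lam1 (i : 'I_T) : \sum_e lam i.+1 e = 1.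
  by rewrite -(mu1 _ (it i)) big_option big_bool_pair addrC.
have muE (i : 'I_T) x :
    mu i.+1 x = \sum_e lam i.+1 e * pure_law nu i.+1 e x.
  rewrite big_option /=; case: x => -[] j /=.
    rewrite mulr0 add0r (bigD1 j)//= eqxx mulr1 big1 ?addr0// => k kj.
    by rewrite xpair_eqE/= eq_sym (negPf kj) mulr0.
  rewrite [X in _ + X]big1 ?addr0 => [|k _]; last by rewrite mulr0.
  by rewrite mulrC divfK// gt_eqF// mF.
under eq_bigr => s _.
  under eq_bigr => i _ do rewrite muE.
  rewrite bigA_distr_bigA mulr_sumr /=.
  over.
rewrite exchange_big/=.
apply: (@le_trans _ _ (\sum_(Y : {ffun 'I_T -> option 'I_N})
    (\prod_(i < T) lam i.+1 (Y i)) * alpha)); last first.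
  rewrite -mulr_suml -(bigA_distr_bigA (fun (i : 'I_T) e => lam i.+1 e)).
  by rewrite big1 ?mul1r.
apply: ler_sum => Y _.
pose y i := if insub i.-1 is Some k then Y k else None.
have yE (i : 'I_T) : y i.+1 = Y i.
  by rewrite /y/= valK.
under eq_bigr => s _ do rewrite big_split/= mulrCA.
rewrite -mulr_sumr ler_wpM2l ?prodr_ge0//.
have := @sum_pure_law R N nu q y T 0 0 0 0 (leqnn 0).
under eq_bigr => s _.
  under [X in _ * X]eq_bigr => i _ do rewrite add0n yE.
  over.
move=> -> => [|i iT|i k iT ki]; first exact: fdp_from_le.
- by rewrite -mulr_suml divff// gt_eqF// mF.
- by rewrite -mulr_suml muq// mulfK// gt_eqF// mF.
Qed.

(** * Weighted p-values of nulls are superuniform *)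
Lemma uniform_prob_le (R : realType) (x : R) : 0 <= x ->
  (uniform_prob (@ltr01 R) `]-oo, x] <= x%:E)%E.
Proof.
move=> x0; rewrite /uniform_prob integral_uniform_pdf.
have mI : measurable (`]-oo, x] `&` `[0, 1] : set R) by exact: measurableI.
apply: (@le_trans _ _ (\int[lebesgue_measure]_(y in `]-oo, x] `&` `[0%R, 1%R]) 1)%E).
  apply: ge0_le_integral => //=.
  - by move=> y _; rewrite lee_fin uniform_pdf_ge0.
  - by apply/measurable_EFinP/measurable_funTS; exact: measurable_uniform_pdf.
  - by move=> y [_]; rewrite in_itv/= /uniform_pdf => ->; rewrite subr0 invr1.
rewrite integral_cst// mul1e.
apply: (@le_trans _ _ (lebesgue_measure `[0%R, x])).
  apply: le_measure; rewrite ?inE//.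
  by move=> y /= []; rewrite !in_itv/= => -> /andP[->].
rewrite lebesgue_measure_itv/= lte_fin.
by case: ifP => _; rewrite -?EFinB ?subr0 ?lee_fin.
Qed.

(** The three cases come from the sign of the denominator, with the convention
    [x / 0 = 0]. *)
Lemma measurable_ratio_le (d : measure_display) (T : measurableType d)
    (R : realType) (f g : T -> R) (a : R) :
  measurable_fun setT f -> measurable_fun setT g ->
  measurable [set x | f x / g x <= a].
Proof.
move=> mf mg; have mag : measurable_fun setT (fun x => a * g x).
  exact: measurable_funM.
have -> : [set x | f x / g x <= a] =
    ([set x | 0 < g x] `&` [set x | f x <= a * g x]) `|`
    ([set x | g x < 0] `&` [set x | a * g x <= f x]) `|`
    ([set x | g x == 0] `&` [set x | 0 <= a]).
  apply/seteqP; split => x /=; case: (ltrgtP (g x) 0) => gx.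
  - by move=> h; left; right; rewrite -ler_ndivrMr.
  - by move=> h; left; left; rewrite -ler_pdivrMr.
  - by rewrite gx invr0 mulr0 => h; right.
  - by case=> [[[]|[_]]|[]]//; rewrite ler_ndivrMr.
  - by case=> [[[_]|[]]|[]]//; rewrite ler_pdivrMr.
  - by case=> [[[]|[]]|[_]]//; rewrite gx invr0 mulr0.
apply: measurableU; first apply: measurableU; apply: measurableI.
- by rewrite -[X in measurable X]setTI; exact: measurable_fun_ltr.
- by rewrite -[X in measurable X]setTI; exact: measurable_fun_ler.
- by rewrite -[X in measurable X]setTI; exact: measurable_fun_ltr.
- by rewrite -[X in measurable X]setTI; exact: measurable_fun_ler.
- by rewrite -[X in measurable X]setTI; exact: measurable_fun_eqr.
- by rewrite -[X in measurable X]setTI; exact: measurable_fun_ler.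
Qed.

Section Ratio.
Context (d : measure_display) (Omega : measurableType d) (R : realType).
Variable P : probability Omega R.
Variables p w : {RV P >-> R}.

Lemma independent2_pair_law (S : set (R * R)) :
  independent2 P w p -> measurable S ->
  P [set x | S (w x, p x)] =
  (\int[distribution P w]_y distribution P p (xsection S y))%E.
Proof.
move=> wp mS.
have mwp : measurable_fun setT (fun x => (w x, p x)) by exact: measurable_fun_pair.
pose wpRV : {RV P >-> (R * R)%type} := HB.pack (fun x => (w x, p x))
  (isMeasurableFun.Build _ _ _ _ _ mwp).
apply/esym/(product_measure_unique (m1 := distribution P w)
  (m2 := distribution P p) (m' := distribution P wpRV)).
  exact: wp.
exact: mS.
Qed.

(** Integrate [P (p <= a * y) <= a * y] against the law of [w]. *)
Lemma ratio_superuniform (a m : R) : 0 <= a ->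
  independent2 P p w ->
  (forall x : R, (0 <= x)%R -> P (p @^-1` `]-oo, x]) <= x%:E)%E ->
  (P (w @^-1` `]0%R, +oo[) = 1)%E ->
  ('E_P[w] = m%:E)%E ->
  (P [set x | (p x / w x <= a)%R] <= (a * m)%:E)%E.
Proof.
move=> a0 pw pU w1 wm.
have wpI : independent2 P w p by move=> A B mA mB; rewrite setIC pw// muleC.
have mw : measurable_fun setT w by [].
have mp : measurable_fun setT p by [].
pose W := [set x | w x <= 0]; pose E := [set x | p x <= a * Num.max (w x) 0].
pose S := [set z : R * R | z.2 <= a * Num.max z.1 0].
have mS : measurable S.
  rewrite -[S]setTI; apply: measurable_fun_ler => //.
  apply: measurable_funM => //; apply: measurable_maxr => //.
have mW : measurable W.
  by rewrite -[W]setTI; apply: measurable_fun_ler.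
have mE : measurable E.
  rewrite -[E]setTI; apply: measurable_fun_ler => //.
  by apply: measurable_funM => //; exact: measurable_maxr.
have PW0 : P W = 0%E.
  have -> : W = ~` (w @^-1` `]0, +oo[).
    apply/seteqP; split => x /=; rewrite in_itv/= andbT.
      by move=> wx; apply/negP; rewrite -leNgt.
    by move/negP; rewrite -leNgt.
  rewrite probability_setC ?w1 ?subee//.
  by rewrite -[_ @^-1` _]setTI; exact: mw.
apply: (@le_trans _ _ (P (W `|` E))).
  apply: le_measure; rewrite ?inE.
  - exact: measurable_ratio_le.
  - exact: measurableU.
  - move=> x /= pwx; case: (lerP (w x) 0) => wx; [by left|right].
    by rewrite /E/= (max_l (ltW wx)) -ler_pdivrMr.
apply: (le_trans (measureU2 _ mW mE)); rewrite /= PW0 add0e.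
rewrite [P E](independent2_pair_law wpI mS).
apply: (@le_trans _ _ (\int[distribution P w]_y (a * Num.max y 0)%:E)%E).
  apply: ge0_le_integral => //=.
  - exact: measurable_fun_xsection.
  - apply/measurable_EFinP; apply: measurable_funM => //.
    exact: measurable_maxr.
  - move=> y _; have -> : xsection S y = `]-oo, a * Num.max y 0]%classic.
      apply/seteqP; split => z; rewrite /xsection/= in_itv/=.
        by rewrite inE.
      by rewrite inE.
    by apply: pU; rewrite mulr_ge0// le_max lexx orbT.
have mmax : measurable_fun setT (fun y : R => Num.max y 0).
  exact: measurable_maxr.
have max0 (y : R) : 0 <= Num.max y 0 by rewrite le_max lexx orbT.
rewrite (@ge0_integral_distribution _ _ _ _ _ _ w); last 2 first.
- by apply/measurable_EFinP; exact: measurable_funM.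
- by move=> y; rewrite lee_fin mulr_ge0.
rewrite (_ : (fun x => _) = (fun x => a%:E * (Num.max (w x) 0)%:E)%E)//.
have mmw : measurable_fun setT (fun x => Num.max (w x) 0).
  exact: measurable_maxr.
rewrite ge0_integralZl ?lee_fin//; last 2 first.
- exact/measurable_EFinP.
- by move=> x _; rewrite lee_fin.
rewrite EFinM lee_wpmul2l ?lee_fin// -wm unlock.
rewrite (ae_eq_integral (fun x => (w x)%:E))//.
- exact/measurable_EFinP.
- exact/measurable_EFinP.
- exists W; split=> // x /=; apply: contra_notP => /negP; rewrite -ltNge => wx _.
  by rewrite max_l// ltW.
Qed.

End Ratio.

(** * Finitely valued random variables *)
Section FiniteExpectation.
Context (d : measure_display) (Omega : measurableType d) (R : realType).
Variable P : probability Omega R.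

Lemma expectation_finite (S : finType) (X : Omega -> S) (phi : S -> R) :
  (forall s, measurable (X @^-1` [set s])) -> (forall s, 0 <= phi s) ->
  ('E_P[phi \o X] = (\sum_s phi s * fine (P (X @^-1` [set s])))%:E)%E.
Proof.
move=> mX phi0; rewrite unlock.
transitivity (\int[P]_x (\sum_s (phi s)%:E * (\1_(X @^-1` [set s]) x)%:E))%E.
  apply: eq_integral => x _; rewrite (bigD1 (X x))//= big1 => [|s sX].
    by rewrite indicE mem_set//= mule1 adde0.
  by rewrite indicE memNset ?mule0//= => /esym/eqP; rewrite (negPf sX).
rewrite ge0_integral_sum//=.
- rewrite -sumEFin; apply: eq_bigr => s _.
  rewrite ge0_integralZl//=.
  - by rewrite integral_indic// setIT EFinM fineK// fin_num_measure.
  - by apply/measurable_EFinP; exact: measurable_indic.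
  - by rewrite lee_fin.
- move=> s; apply: measurable_funeM; apply/measurable_EFinP.
  exact: measurable_indic.
- by move=> s x _; rewrite mule_ge0// lee_fin.
Qed.

End FiniteExpectation.

(** * The LORD++ decisions in terms of tiers *)
Section LastRejection.
Variable rej : nat -> bool.

Lemma last_rejection1 : last_rejection rej 1 = 0%N.
Proof. by rewrite /last_rejection big_geq. Qed.

Lemma last_rejection_ltn t : (0 < t)%N -> (last_rejection rej t < t)%N.
Proof.
move=> t0; rewrite /last_rejection big_seq_cond.
elim/big_ind: _ => [//|m n mt nt|i]; first by rewrite gtn_max mt.
by rewrite mem_index_iota => /andP[/andP[]].
Qed.

Lemma last_rejectionS t : (0 < t)%N ->
  last_rejection rej t.+1 = if rej t then t else last_rejection rej t.
Proof.
move=> t0; rewrite {1}/last_rejection big_mkcond big_nat_recr//= -big_mkcond/=.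
rewrite -/(last_rejection rej t); case: (rej t); last by rewrite maxn0.
by apply/maxn_idPr/ltnW/last_rejection_ltn.
Qed.

Lemma no_rejection_beforeE t :
  no_rejection_before rej t = (last_rejection rej t == 0%N).
Proof.
elim: t => [|[|t] IHt]; first by rewrite /last_rejection big_geq.
  by rewrite last_rejection1.
rewrite last_rejectionS//; move: IHt; rewrite /no_rejection_before.
have -> : index_iota 1 t.+2 = rcons (index_iota 1 t.+1) t.+1.
  by rewrite /index_iota !subn1/= -cats1 -(iotaD 1 t 1) addn1.
rewrite -cats1 has_cat negb_or => ->.
by rewrite /= orbF; case: (rej t.+1); rewrite ?andbF ?andbT.
Qed.

End LastRejection.

Section Tiers.
Context {R : realType}.
Variable lev : nat -> nat -> R.

(** As [lev j t] increases with [j], the decision on [z] at time [t] depends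
    only on the first [j] such that [z <= lev j t]. *)
Definition tier (t : nat) (z : R) : nat :=
  find (fun j => z <= lev j t) (iota 0 t).

Lemma tier_leq t z : (tier t z <= t)%N.
Proof. by rewrite -[leqRHS](size_iota 0 t) find_size. Qed.

Hypothesis lev_homo : forall j k t, (j <= k < t)%N -> lev j t <= lev k t.

Lemma leq_tier t z k : (k < t)%N -> (tier t z <= k)%N = (z <= lev k t).
Proof.
move=> kt; apply/idP/idP => [tk|zk].
  have tt := leq_ltn_trans tk kt.
  have := tt; rewrite -[X in (_ < X)%N -> _](size_iota 0 t) -has_find.
  move=> /(nth_find 0%N); rewrite nth_iota// add0n => /le_trans; apply.
  by rewrite lev_homo// tk.
rewrite leqNgt; apply/negP => /(before_find 0%N).
by rewrite nth_iota// add0n zk.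
Qed.

End Tiers.

Lemma measurable_find (d : measure_display) (T : measurableType d)
    (a : nat -> T -> bool) (Q : pred nat) m n :
  (forall j, measurable [set x | a j x]) ->
  measurable [set x | Q (find (a^~ x) (iota m n))].
Proof.
move=> ma; have mb (b : bool) : measurable [set x : T | b].
  case: b; first by rewrite (_ : [set x | true] = setT)//; apply/seteqP; split.
  by rewrite (_ : [set x | false] = set0)//; apply/seteqP; split.
elim: n m Q => [|n IHn] m Q; first exact: (mb (Q 0%N)).
have -> : [set x | Q (find (a^~ x) (iota m n.+1))] =
  ([set x | a m x] `&` [set _ | Q 0%N]) `|`
  (~` [set x | a m x] `&` [set x | (Q \o succn) (find (a^~ x) (iota m.+1 n))]).
  apply/seteqP; split => x /=; case: ifP => amx.
  - by left.
  - by right; split.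
  - by case=> -[].
  - by case=> -[].
apply: measurableU; apply: measurableI => //.
exact: measurableC.
Qed.

(** The recursion on the last rejection and the counts of rejections computes
    the false discovery proportion of the decisions it describes. *)
Section Replay.
Variables (R : realType) (N : nat) (rej H : nat -> bool) (T : nat).
Variable x : nat -> bool * 'I_N.
Hypothesis xH : forall t, (0 < t <= T)%N -> (x t).1 = H t.
Hypothesis xrej : forall t, (0 < t <= T)%N ->
  rej t = ((x t).2 <= last_rejection rej t)%N.

Let v t := num_false_rejections H rej t.
Let u t := (\sum_(1 <= i < t.+1 | H i) rej i)%N.

Lemma num_rejectionsE t : num_rejections rej t = (v t + u t)%N.
Proof. by rewrite /num_rejections (bigID (fun i => H i))/= addnC. Qed.

Lemma path_fdp_replay n t : (t + n = T)%N ->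
  path_fdp [seq x i | i <- iota t.+1 n] t (last_rejection rej t.+1) (v t) (u t)
  = (v T)%:R / (v T + u T)%:R :> R.
Proof.
elim: n t => [|n IHn] t tn; first by rewrite -tn addn0.
have tT : (0 < t.+1 <= T)%N by rewrite -tn addnS/= ltnS leq_addr.
move: tn; rewrite -addSnnS => /IHn {}IHn.
rewrite last_rejectionS// in IHn.
rewrite [iota _ _]/= [map _ _]/= [LHS]/=; rewrite -xrej// xH// -{}IHn.
have vS : v t.+1 = (v t + (if ~~ H t.+1 then rej t.+1 else false))%N.
  rewrite /v /num_false_rejections !(big_mkcond (fun i => ~~ H i)).
  by rewrite big_nat_recr//=; case: (H t.+1).
have uS : u t.+1 = (u t + (if H t.+1 then rej t.+1 else false))%N.
  rewrite /u !(big_mkcond (fun i => H i)).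
  by rewrite big_nat_recr//=; case: (H t.+1).
rewrite vS uS.
by case: (rej t.+1); case: (H t.+1); rewrite /= ?addn0 ?addn1.
Qed.

Lemma fdp_replay :
  (num_false_rejections H rej T)%:R / (maxn (num_rejections rej T) 1)%:R =
  path_fdp [seq x i | i <- iota 1 T] 0 0 0 0 :> R.
Proof.
have := @path_fdp_replay T 0 (add0n T).
have [-> ->] : v 0%N = 0%N /\ u 0%N = 0%N.
  by rewrite /v /u /num_false_rejections !big_geq.
rewrite last_rejection1 => ->.
rewrite num_rejectionsE -/(v T); case: (posnP (v T + u T)) => [vu|vu].
  by move/eqP: vu; rewrite addn_eq0 => /andP[/eqP -> _]; rewrite !mul0r.
by rewrite (maxn_idPl vu).
Qed.

End Replay.

Section Levels.
Context {R : realType}.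
Variables (alpha w0 : R) (gamma : nat -> R).
Hypothesis w0_bounds : 0 <= w0 <= alpha.
Hypothesis gamma_ge0 : forall t, (0 < t)%N -> 0 <= gamma t.
Hypothesis gamma_nonincr :
  forall s t, (0 < s)%N -> (s <= t)%N -> gamma t <= gamma s.
Hypothesis gamma_sum1 : (\sum_(1 <= t <oo) (gamma t)%:E = 1)%E.

(** The level of test [t] as a function of the time [tau] of the last
    rejection, with [tau = 0] before the first one. *)
Definition level (tau t : nat) : R :=
  gamma (t - tau) * (alpha - w0 * (tau == 0%N)%:R).

Lemma lordpp_levelE rej t :
  lordpp_level alpha w0 gamma rej t = level (last_rejection rej t) t.
Proof. by rewrite /lordpp_level /lordpp_reward no_rejection_beforeE. Qed.

Lemma level_ge0 tau t : (tau < t)%N -> 0 <= level tau t.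
Proof.
move=> tt; have /andP[wl wu] := w0_bounds.
rewrite mulr_ge0 ?gamma_ge0 ?subn_gt0//.
by case: eqP => _; rewrite ?mulr1 ?mulr0; lra.
Qed.

Lemma level_homo j k t : (j <= k < t)%N -> level j t <= level k t.
Proof.
move=> /andP[jk kt]; have /andP[wl wu] := w0_bounds.
have jt := leq_ltn_trans jk kt.
rewrite /level ler_pM ?gamma_ge0 ?subn_gt0//.
- by case: eqP => _; rewrite ?mulr1 ?mulr0; lra.
- by rewrite gamma_nonincr ?subn_gt0 ?leq_sub2l.
- move: jk; case: (j =P 0%N) => [->|j0]; case: (k =P 0%N) => [k0|_] jk;
    rewrite ?mulr1 ?mulr0; try lra.
  by move: jk; rewrite k0 leqn0 => /eqP.
Qed.

(** Each segment spends at most [alpha]; this includes the first one, as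
    [alpha - w0 <= alpha]. *)
Lemma level_budget tau n :
  \sum_(tau.+1 <= i < tau.+1 + n) level tau i <= alpha.
Proof.
have /andP[wl wu] := w0_bounds; have alpha0 := le_trans wl wu.
rewrite -mulr_suml.
have -> : \sum_(tau.+1 <= i < tau.+1 + n) gamma (i - tau) =
    \sum_(1 <= i < n.+1) gamma i.
  rewrite -[X in \sum_(X <= _ < _) _ = _](add1n tau).
  have -> : (tau.+1 + n)%N = (n.+1 + tau)%N by rewrite addSn addnC.
  rewrite -[X in \sum_(_ <= _ < X) _](subnK (leq_addl n.+1 tau)) addnK.
  by rewrite big_addn addnK; apply: eq_bigr => i _; rewrite addnK.
have g1 : \sum_(1 <= i < n.+1) gamma i <= 1.
  rewrite -lee_fin -sumEFin -gamma_sum1.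
  apply: nneseries_lim_ge => i i1 _.
  by rewrite lee_fin gamma_ge0.
have g0 : 0 <= \sum_(1 <= i < n.+1) gamma i.
  rewrite big_seq; apply: sumr_ge0 => i.
  by rewrite mem_index_iota => /andP[/gamma_ge0].
apply: (@le_trans _ _ ((\sum_(1 <= i < n.+1) gamma i) * alpha)); last first.
  by rewrite ler_piMl.
rewrite ler_wpM2l//.
by case: eqP => _; rewrite ?mulr1 ?mulr0; lra.
Qed.

End Levels.

(** * Laws in the mixture model *)
Section Conditioning.
Context (d : measure_display) (Omega : measurableType d) (R : realType).

Lemma givenE (P : probability Omega R) (X : {mfun Omega >-> bool}) b A :
  measurable A -> P (X @^-1` [set b]) != 0%E ->
  P (A `&` X @^-1` [set b]) = (P (X @^-1` [set b]) * given P X b A)%E.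
Proof.
move=> mA Pb; rewrite /given /cond_prob /= /mnormalize /= /mrestr !setTI.
have PX := fin_num_measure P _ (measurable_value X b).
rewrite (negPf Pb) (negbTE (_ : P _ != +oo%E))/=; last first.
  by rewrite lt_eqF// -ge0_fin_numE.
rewrite muleC -muleA -[X in (_ * (_ * X))%E](fineK PX) -EFinM mulVf ?mule1//.
by rewrite fine_eq0.
Qed.

Lemma measurable_finite_preimage (S : finType) (X : Omega -> S) (Q : pred S) :
  (forall s, measurable (X @^-1` [set s])) -> measurable [set x | Q (X x)].
Proof.
move=> mX; have -> : [set x | Q (X x)] = \bigcup_(s in [set` Q]) (X @^-1` [set s]).
  by apply/seteqP; split => [x Qx|x [s Qs /= ->]//]; exists (X x).
by apply: fin_bigcup_measurable => //; exact: finite_finpred.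
Qed.

Lemma sum_finite_law (P : probability Omega R) (S : finType) (X : Omega -> S)
    (Q : pred S) :
  (forall s, measurable (X @^-1` [set s])) ->
  \sum_(s | Q s) fine (P (X @^-1` [set s])) = fine (P [set x | Q (X x)]).
Proof.
move=> mX; have mQ := measurable_finite_preimage Q mX.
have := expectation_finite P (phi := fun s => (Q s)%:R) mX (fun=> ler0n _ _).
rewrite [X in 'E_P[X]%E](_ : _ = \1_[set x | Q (X x)]); last first.
  apply/funext => x; rewrite indicE/=.
  by case: (boolP (Q (X x))) => Qx; [rewrite mem_set|rewrite memNset//; exact/negP].
rewrite expectation_indic// => -> /=.
rewrite [LHS]big_mkcond; apply: eq_bigr => s _.
by case: (Q s); rewrite ?mul1r ?mul0r.
Qed.

End Conditioning.

Section Outcomes.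
Context (d : measure_display) (Omega : measurableType d) (R : realType).
Variable P : probability Omega R.
Variables (H : nat -> {RV P >-> bool}) (p w : nat -> {RV P >-> R}).
Variables (lev : nat -> nat -> R) (T : nat).

(** The tier is at most [t], so it is not truncated by [inord] if [t <= T]. *)
Definition ranked (t : nat) (z : bool * R * R) : bool * 'I_T.+1 :=
  (z.1.1, inord (tier lev t (z.1.2 / z.2))).

Definition outcome (t : nat) (x : Omega) : bool * 'I_T.+1 :=
  ranked t (H t x, p t x, w t x).

Lemma measurable_ranked t y : measurable (ranked t @^-1` [set y]).
Proof.
have -> : ranked t @^-1` [set y] = [set z | z.1.1 == y.1] `&`
    [set z | inord (tier lev t (z.1.2 / z.2)) == y.2].
  apply/seteqP; split => [z <-|z [/eqP h1 /eqP h2]]; first by split => /=.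
  by rewrite /= /ranked h1 h2 -surjective_pairing.
apply: measurableI.
  have m11 : measurable_fun setT (fun z : bool * R * R => z.1.1).
    exact: measurableT_comp measurable_fst measurable_fst.
  have := m11 measurableT [set y.1] I; rewrite setTI.
  by congr measurable; apply/seteqP; split => z /= /eqP.
apply: (@measurable_find _ _ (fun j (z : bool * R * R) => z.1.2 / z.2 <= lev j t)
  (fun k => inord k == y.2)) => j.
apply: measurable_ratio_le => //.
exact: measurableT_comp measurable_snd measurable_fst.
Qed.

Lemma measurable_outcome t y : measurable (outcome t @^-1` [set y]).
Proof.
have mX : measurable_fun setT (fun x => (H t x, p t x, w t x)).
  by apply: measurable_fun_pair => //; exact: measurable_fun_pair.
have := mX measurableT _ (measurable_ranked t y).
by rewrite setTI.
Qed.

Hypothesis indep : mutually_independent P (fun t x => (H t x, p t x, w t x)).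

Definition outcomes (x : Omega) : T.-tuple (bool * 'I_T.+1) :=
  [tuple outcome i.+1 x | i < T].

Lemma outcomes_preimage s : outcomes @^-1` [set s] =
  \big[setI/setT]_(t <- index_iota 1 T.+1)
    ((fun x => (H t x, p t x, w t x)) @^-1`
       (ranked t @^-1` [set nth (false, ord0) s t.-1])).
Proof.
rewrite -bigcap_seq; apply/seteqP; split => x /=.
  move=> <- t; rewrite [X in X -> _]/= mem_index_iota; case: t => // t /andP[_ tT].
  have := tnth_nth (false, ord0) (outcomes x) (Ordinal (tT : t < T)%N).
  by rewrite tnth_mktuple.
move=> xs; apply: eq_from_tnth => i; rewrite tnth_mktuple.
have iT : i.+1 \in index_iota 1 T.+1.
  by rewrite mem_index_iota; exact: (ltn_ord i).
have := xs i.+1; rewrite /= iT /outcome => /(_ isT) ->.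
by rewrite -tnth_nth.
Qed.

Lemma measurable_outcomes s : measurable (outcomes @^-1` [set s]).
Proof.
rewrite outcomes_preimage; apply: bigsetI_measurable => t _.
exact: measurable_outcome.
Qed.

Lemma outcomes_law s : fine (P (outcomes @^-1` [set s])) =
  \prod_(i < T) fine (P (outcome i.+1 @^-1` [set tnth s i])).
Proof.
rewrite outcomes_preimage indep ?iota_uniq//; last 2 first.
- by apply/allP => t; rewrite mem_index_iota => /andP[].
- by move=> t; exact: measurable_ranked.
rewrite (eq_bigr (fun t =>
  (fine (P (outcome t @^-1` [set nth (false, ord0) s t.-1])))%:E)); last first.
  by move=> t _; rewrite fineK// fin_num_measure//; exact: measurable_outcome.
rewrite prodEFin/= big_add1/= big_mkord; apply: eq_bigr => i _.
by rewrite -tnth_nth.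
Qed.

End Outcomes.

Section NullTests.
Context (d : measure_display) (Omega : measurableType d) (R : realType).
Variable P : probability Omega R.
Variables (H : nat -> {RV P >-> bool}) (p w : nat -> {RV P >-> R}).
Variables (pi1 : R) (F : R -> R) (Q0 Q1 : probability R R) (u0 : R).
Hypothesis Hmix : mixture_model H p w pi1 F Q0 Q1.
Hypothesis Hu0 :
  forall t, (0 < t)%N -> ('E_(given P (H t) false)[w t] = u0%:E)%E.

Lemma null_prob t : (0 < t)%N -> P (H t @^-1` [set false]) = (1 - pi1)%:E.
Proof.
move=> t0; have /andP[pi0 pi1_] := mix_pi1 Hmix.
have := mix_H Hmix t0 (A := [set false]) I; rewrite /distribution /pushforward => ->.
rewrite bernoulli_probE ?(ltW pi0) ?(ltW pi1_)//= !diracE.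
by rewrite memNset//= mem_set//= mule0 add0e mule1.
Qed.

Lemma null_prob_inter t A : (0 < t)%N -> measurable A ->
  fine (P (A `&` H t @^-1` [set false])) =
  (1 - pi1) * fine (given P (H t) false A).
Proof.
move=> t0 mA; have /andP[pi0 pi1_] := mix_pi1 Hmix.
rewrite givenE// null_prob//; last by rewrite eqe gt_eqF// subr_gt0.
by rewrite fineM// fin_num_measure.
Qed.

Lemma null_ratio_superuniform t a : (0 < t)%N -> 0 <= a ->
  fine (given P (H t) false [set x | p t x / w t x <= a]) <= a * u0.
Proof.
move=> t0 a0; rewrite -lee_fin fineK; last first.
  by apply: fin_num_measure; exact: measurable_ratio_le.
apply: (@ratio_superuniform _ _ _ (given P (H t) false) (p t) (w t)) => //.
- exact: mix_cond_indep Hmix t false t0.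
- move=> x x0; have := @mix_p_null _ _ _ _ _ _ _ _ _ _ _ Hmix t `]-oo, x] t0.
  by rewrite /distribution /pushforward => ->//; exact: uniform_prob_le.
- have := @mix_w_null _ _ _ _ _ _ _ _ _ _ _ Hmix t `]0, +oo[ t0.
  rewrite /distribution /pushforward => ->//.
  by have [] := mix_Q0 Hmix.
- exact: Hu0.
Qed.

End NullTests.

(** * Control of the FDR *)

Theorem proposition1 (R : realType) (d : measure_display)
    (Omega : measurableType d) (P : probability Omega R)
    (H : nat -> {RV P >-> bool}) (p w : nat -> {RV P >-> R})
    (pi1 : R) (F : R -> R) (Q0 Q1 : probability R R)
    (u0 u1 : R) (alpha w0 : R) (gamma : nat -> R)
    (Hmix : mixture_model H p w pi1 F Q0 Q1)
    (Hu0 : forall t, (0 < t)%N -> ('E_(given P (H t) false)[w t] = u0%:E)%E)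
    (Hu1 : forall t, (0 < t)%N -> ('E_(given P (H t) true)[w t] = u1%:E)%E)
    (u0_lt1 : u0 < 1) (u1_gt1 : 1 < u1)
    (Hu : (1 - pi1) * u0 + pi1 * u1 = 1)
    (Hp_indep : mutually_independent P (fun t => p t))
    (Hpw_cond_indep :
       cond_independent_families P H (fun t => p t) (fun t => w t))
    (Halpha : 0 < alpha < 1)
    (Hw0 : alpha / 2 <= w0 < alpha)
    (gamma_ge0 : forall t, (0 < t)%N -> 0 <= gamma t)
    (gamma_nonincr : forall s t, (0 < s)%N -> (s <= t)%N -> gamma t <= gamma s)
    (gamma_sum1 : (\sum_(1 <= t <oo) (gamma t)%:E = 1)%E) :
  (ereal_sup [set FDR P (fun t => H t)
                (weighted_lordpp alpha w0 gamma (fun t => p t) (fun t => w t)) T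
             | T in [set T | (0 < T)%N]] <= alpha%:E)%E.
Proof.
have /andP[a0 a1] := Halpha; have /andP[wl wu] := Hw0.
have /andP[pi0 pi1_] := mix_pi1 Hmix.
have alpha01 : 0 <= alpha < 1 by rewrite ltW.
have w0_bounds : 0 <= w0 <= alpha by apply/andP; split; lra.
pose lev := level alpha w0 gamma.
have lev_homo : forall j k t, (j <= k < t)%N -> lev j t <= lev k t.
  exact: level_homo.
apply/ereal_supP => _ [T _ <-].
have rk t x k : (0 < t <= T)%N -> (k < t)%N ->
    ((outcome H p w lev T t x).2 <= k)%N = (p t x / w t x <= lev k t).
  move=> /andP[t0 tT] kt; rewrite /outcome /ranked/= inordK ?leq_tier//.
  by rewrite ltnS (leq_trans (tier_leq _ _ _)).
pose X := outcomes H p w lev T.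
have fdpE x : (num_false_rejections ((fun t => H t) ^~ x)
      (weighted_lordpp alpha w0 gamma p w x) T)%:R /
    (maxn (num_rejections (weighted_lordpp alpha w0 gamma p w x) T) 1)%:R =
    path_fdp (X x) 0 0 0 0 :> R.
  rewrite (@fdp_replay R T.+1 _ _ T (fun t => outcome H p w lev T t x)) => //.
    congr path_fdp; rewrite /X /outcomes /= -[1%N]addn0 iotaDl -map_comp.
    by rewrite -val_enum_ord -map_comp.
  move=> t tT; have /andP[t0 _] := tT.
  by rewrite rk ?last_rejection_ltn// /weighted_lordpp lordppE// lordpp_levelE.
rewrite /FDR (_ : (fun x => _) =
  (fun s : T.-tuple _ => path_fdp s 0 0 0 0) \o X); last first.
  by apply/funext => x; exact: fdpE.
rewrite expectation_finite; last 2 first.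
- exact: measurable_outcomes.
- by move=> s; exact: path_fdp_ge0.
rewrite lee_fin; under eq_bigr do rewrite (outcomes_law _ (mix_indep Hmix)).
pose Z t k := [set x | p t x / w t x <= lev k t].
have mZ t k : measurable (Z t k) by exact: measurable_ratio_le.
(* Zero outside the times to which a level corresponds, so that the budget
   holds over any horizon. *)
pose q t k : R := if (0 < t)%N && (k < t)%N
  then fine (given P (H t) false (Z t k)) else 0.
pose mu t y := fine (P (outcome H p w lev T t @^-1` [set y])).
have muE t (Q : pred 'I_T.+1) : \sum_(j | Q j) mu t (false, j) =
    fine (P [set x | Q (outcome H p w lev T t x).2 && ~~ H t x]).
  pose Q' (y : bool * 'I_T.+1) := Q y.2 && ~~ y.1.
  rewrite -(sum_finite_law P Q' (@measurable_outcome _ _ _ P H p w lev T t)).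
  rewrite [RHS]big_mkcond big_bool_pair/= [X in _ = X + _]big1 => [|j _].
    by rewrite add0r [LHS]big_mkcond; apply: eq_bigr => j _; rewrite /Q'/= andbT.
  by rewrite /Q' andbF.
have muF t : (0 < t)%N -> \sum_j mu t (false, j) = 1 - pi1.
  move=> t0; rewrite muE -[RHS]/(fine (1 - pi1)%:E) -(null_prob Hmix t0).
  congr (fine (P _)); apply/seteqP; split => x /=; first by move=> /negPf.
  by move=> ->.
apply: (@path_fdp_mean_le R T.+1 alpha mu q T alpha01).
- by move=> i k; rewrite /q; case: ifP => // _; rewrite fine_ge0.
- move=> tau n; apply: le_trans (level_budget w0_bounds gamma_ge0 gamma_sum1 tau n).
  rewrite big_seq [leRHS]big_seq; apply: ler_sum => i.
  rewrite mem_index_iota => /andP[ti _]; rewrite /q ti (leq_trans _ ti)//=.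
  have l0 : 0 <= lev tau i by exact: level_ge0.
  apply: (le_trans (null_ratio_superuniform Hmix Hu0 _ l0)).
    exact: leq_trans ti.
  by rewrite ler_piMr// ltW.
- by move=> i x; rewrite fine_ge0.
- move=> i _.
  rewrite (sum_finite_law P predT (@measurable_outcome _ _ _ P H p w lev T i)).
  rewrite (_ : [set x | _] = setT) ?probability_setT//.
  by apply/seteqP; split.
- by move=> i /andP[i0 _]; rewrite muF// subr_gt0.
- move=> i k /andP[i0 iT] ki; rewrite muF// muE /q i0 ki/=.
  rewrite mulrC -(null_prob_inter Hmix i0)//; congr (fine (P _)).
  have iT' : (0 < i <= T)%N by rewrite i0.
  apply/seteqP; split => x.
    by move=> /andP[]; rewrite rk// => h /negPf.
  by move=> [h hF]; apply/andP; rewrite rk//; split=> //; rewrite hF.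
Qed.
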